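(* Let $U$ be a countably infinite set and $\mathrm{G}$ a subgroup of $\mathfrak{S}(U)$. Then for every subset $S$ of $U$, the ranked closure $\mathfrak{rc}(S)$ is the least element (with respect to inclusion) of $\overline{\overline{\mathrm{G}}[U]}$ containing $S$, where $\overline{\overline{\mathrm{G}}[U]}$ is the topological closure of $\overline{\mathrm{G}}[U]$ in $\mathcal{P}(U)$ for the powerset topology.
   Context: $\overline{\mathrm{G}}$ is the closure of $\mathrm{G}$ in $U^U$ for the function topology (maps $f:U\to U$ such that every finite restriction of $f$ is a restriction of some $g\in\mathrm{G}$); $\overline{\mathrm{G}}[U]=\{f[U]\mid f\in\overline{\mathrm{G}}\}$. The powerset topology on $\mathcal{P}(U)$ has basic open sets $\{A\subseteq U\mid F\subseteq A,\ E\cap A=\emptyset\}$, $F,E$ finite. For $F\subseteq U$, $\mathrm{G}\langle F\rangle=\{g\in\mathrm{G}\mid g(x)=x\ \forall x\in F\}$. A type is a pair $\langle F\mid p\rangle$ with $F$ finite, $p\in U$; its typeset is $\mathrm{G}\langle F\mid p\rangle=\{g(p)\mid g\in\mathrm{G}\langle F\rangle\}$. $\mathfrak{R}_0$ is the set of types with finite typeset; $\langle F\mid p\rangle\in\mathfrak{R}_\alpha$ if there is a finite $F'\supseteq F$ such that for every $q\in\mathrm{G}\langle F\mid p\rangle$, $\langle F'\mid q\rangle\in\mathfrak{R}_\beta$ for some $\beta<\alpha$. A type is ranked if it lies in some $\mathfrak{R}_\alpha$. For finite $F$, $\mathfrak{rc}(F)$ is $F$ together with the union of the typesets of the ranked types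 $\langle F\mid p\rangle$; for arbitrary $S$, $\mathfrak{rc}(S)=\bigcup\{\mathfrak{rc}(F)\mid F\text{ a finite subset of } S\}$. *)

(* Defs.v *)
From HB Require Import structures.
From mathcomp Require Import all_boot.
From mathcomp Require Import all_classical.
From mathcomp Require Import wochoice.
From mathcomp Require Import topology.

Set Implicit Arguments.
Unset Strict Implicit.
Unset Printing Implicit Defensive.

Local Open Scope classical_set_scope.

Section PowersetTopology.
Variable U : Type.

Definition powerset_topology := set U.

HB.instance Definition _ := Choice.copy powerset_topology (set U).

Definition powerset_base (FE : set U * set U) : set powerset_topology :=
  [set A : set U | FE.1 `<=` A /\ FE.2 `&` A = set0].

Definition powerset_base_index : set (set U * set U) :=
  [set FE | finite_set FE.1 /\ finite_set FE.2].

Lemma powerset_base_cover :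
  \bigcup_(FE in powerset_base_index) powerset_base FE = setT.
Proof.
apply/seteqP; split=> // A _; exists (set0, set0).
  by split; exact: finite_set0.
by split=> /=; [exact: sub0set | rewrite set0I].
Qed.

Lemma powerset_base_join (i j : set U * set U) (A : powerset_topology) :
  powerset_base_index i -> powerset_base_index j ->
  powerset_base i A -> powerset_base j A ->
  exists k, [/\ powerset_base_index k, powerset_base k A &
    powerset_base k `<=` powerset_base i `&` powerset_base j].
Proof.
case: i j => [F E] [F' E'] [/= fF fE] [/= fF' fE'] [/= FA EA] [/= F'A E'A].
exists (F `|` F', E `|` E'); split.
- by split=> /=; rewrite finite_setU.
- split=> /=; first by rewrite subUset.
  by rewrite setIUl EA E'A setU0.
- move=> B [/=]; rewrite subUset setIUl setU_eq0 => -[FB F'B] [EB E'B].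
  by split; split.
Qed.

HB.instance Definition _ := isBaseTopological.Build powerset_topology
  powerset_base_cover powerset_base_join.

End PowersetTopology.

Section RankedClosure.
Variable U : choiceType.

Definition permutation_group (G : set (U -> U)) : Prop :=
  [/\ forall g, G g -> bijective g,
      G id,
      forall f g, G f -> G g -> G (f \o g) &
      forall f g, G f -> cancel f g -> cancel g f -> G g].

(* U^U carries the product topology of the discrete topology on U. *)
Definition Gbar (G : set (U -> U)) : set (U -> U) :=
  closure (G : set {ptws U -> discrete_topology U}).

Definition Gbar_images (G : set (U -> U)) : set (set U) :=
  [set range f | f in Gbar G].

Definition Gbar_images_closure (G : set (U -> U)) : set (set U) :=
  closure (Gbar_images G : set (powerset_topology U)).

Definition pointwise_stabilizer (G : set (U -> U)) (F : set U) : set (U -> U) :=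
  [set g | G g /\ forall x, F x -> g x = x].

(* A type <F | p> is passed as two arguments; finiteness of F is required
   wherever a base F is introduced. *)
Definition typeset (G : set (U -> U)) (F : set U) (p : U) : set U :=
  [set g p | g in pointwise_stabilizer G F].

(* Ordinals are elements of a well-ordered type W, the ordinal of an element
   being the order type of its proper initial segment: 0 is the minimum of W,
   and b < a reads [le b a /\ b <> a].  The second constructor needs no a > 0:
   a typeset is never empty, so for the minimum its premise fails. *)
Inductive in_rank (G : set (U -> U)) (W : Type) (le : rel W) (a : W)
    (F : set U) (p : U) : Prop :=
| InRank0 : (forall b, le a b) -> finite_set F ->
    finite_set (typeset G F p) -> in_rank G le a F p
| InRankS (F' : set U) : finite_set F -> finite_set F' -> F `<=` F' ->
    (forall q, typeset G F p q ->
       exists b, (le b a /\ b <> a) /\ in_rank G le b F' q) ->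
    in_rank G le a F p.

Definition ranked (G : set (U -> U)) (F : set U) (p : U) : Prop :=
  exists (W : Type) (le : rel W), well_order le /\
    exists a : W, in_rank G le a F p.

Definition rc_fin (G : set (U -> U)) (F : set U) : set U :=
  F `|` \bigcup_(p in ranked G F) typeset G F p.

Definition rc (G : set (U -> U)) (S : set U) : set U :=
  \bigcup_(F in [set F | finite_set F /\ F `<=` S]) rc_fin G F.

Definition least_containing (C : set (set U)) (S X : set U) : Prop :=
  [/\ C X, S `<=` X & forall Y, C Y -> S `<=` Y -> X `<=` Y].

End RankedClosure.

(* Main.v *)
(* Being ranked over F is the least property of points that holds of points
   with a finite G<F>-orbit and is inherited from a whole orbit over a larger
   finite base; so rc is a closure operator, and inductions along ranks replace
   computations with ordinals.  If f in Gbar fixes F pointwise, then its range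
   contains every point ranked over F, hence every Y in the closure of
   Gbar[U] with S <= Y contains rc(S).  Conversely, a finite set E of points
   unranked over H can be moved by a single k in G<H> off rc(H') for any finite
   H' >= H: order E by "x is ranked over H and y", move a minimal element, which
   takes care of its whole class, and treat the other points over the larger
   base.  Iterating along an enumeration of U yields f in Gbar whose range
   contains a given finite part of rc(S) and avoids a given finite set disjoint
   from rc(S). *)

Require Import Defs.
From mathcomp Require Import all_boot all_classical topology.
From mathcomp Require wochoice.

Local Open Scope classical_set_scope.
Local Open Scope card_scope.

Set Implicit Arguments.
Unset Strict Implicit.
Unset Printing Implicit Defensive.

(** [R] is only transitive, so minimality is meant up to mutual [R]-relation. By induction, the head
    replaces the minimum of the tail only if it lies strictly below it. *)
Lemma finite_minimal (T : eqType) (R : T -> T -> Prop) (s : seq T) :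
  (forall x y z, R x y -> R y z -> R x z) -> s <> [::] ->
  exists2 m, m \in s & forall x, x \in s -> R x m -> R m x.
Proof.
move=> Rtr; elim: s => // a s IH _.
case: (pselect (s = [::])) => [->|/IH[m ms mmin]].
  by exists a; rewrite ?mem_head// => x; rewrite inE => /eqP ->.
have [Ram|nRam] := pselect (R a m); last first.
  exists m; first by rewrite inE ms orbT.
  by move=> x; rewrite inE => /predU1P[->|/mmin].
have [Rma|nRma] := pselect (R m a).
  exists m; first by rewrite inE ms orbT.
  by move=> x; rewrite inE => /predU1P[->|/mmin].
exists a; rewrite ?mem_head// => x; rewrite inE => /predU1P[->//|xs Rxa].
exact: Rtr _ _ _ Ram (mmin _ xs (Rtr _ _ _ Rxa Ram)).
Qed.

(** * Lexicographic sums of well-orders *)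

Section WellOrderSum.
Variables (I : choiceType) (leI : rel I) (W : I -> Type).
Variable le : forall i, rel (W i).
Hypothesis woI : wochoice.well_order leI.
Hypothesis wo : forall i, wochoice.well_order (@le i).

(** [None] is the added top element. The equality [e] transports [x'] into the summand of [y'],
    where the two can be compared. *)
Definition sum_le (x y : option {i : I & W i}) : Prop :=
  match x, y with
  | _, None => True
  | None, Some _ => False
  | Some (existT i x'), Some (existT j y') =>
      (i <> j /\ leI i j) \/ exists e : i = j, le (eq_rect i W x' j e) y'
  end.

Definition sum_leb : rel (option {i : I & W i}) := fun x y => `[< sum_le x y >].

Lemma sum_le_same i (x y : W i) :
  sum_le (Some (existT W i x)) (Some (existT W i y)) <-> le x y.
Proof.
split=> [[[]//|[e]]|lxy]; first by rewrite (Prop_irrelevance e erefl).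
by right; exists erefl.
Qed.

(** Minima are unique in a well-order. Singletons give reflexivity, so [x] and [y] are both minima
    of the pair they form. *)
Lemma well_order_antisym T (R : rel T) x y :
  wochoice.well_order R -> R x y -> R y x -> x = y.
Proof.
move=> Rwo Rxy Ryx.
have [|z [_ zuniq]] := Rwo [pred t | `[< t = x \/ t = y >]].
  by exists x; apply/asboolP; left.
have Rt t : R t t.
  have [|m [[/asboolP mt mmin] _]] := Rwo [pred u | `[< u = t >]].
    by exists t; apply/asboolP.
  by have := mmin t; rewrite mt; apply; apply/asboolP.
rewrite -(zuniq x) ?(zuniq y)//; split; [|move=> t /asboolP[]-> //|
  |move=> t /asboolP[]-> //]; by apply/asboolP; [right + left].
Qed.

Lemma sum_well_order : wochoice.well_order sum_leb.
Proof.
apply: wochoice.antisymmetric_well_order.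
  move=> [[i x]|] [[j y]|] //= /andP[/asboolP/= xy /asboolP/= yx] //.
  have [ij|nij] := eqVneq i j.
    subst j; congr (Some (existT _ _ _)).
    by apply: (well_order_antisym (wo (i:=i))); apply/sum_le_same.
  case: xy yx => [[_ ij]|[e]]; last by rewrite e eqxx in nij.
  case=> [[_ ji]|[e]]; last by rewrite e eqxx in nij.
  by rewrite (well_order_antisym woI ij ji) eqxx in nij.
move=> A [a aA].
have [[t tA]|noA] := pselect (exists t, Some t \in A); last first.
  exists a; split=> // -[t|_]; first by move=> tA; case: noA; exists t.
  by apply/asboolP; case: (a) => [[]|].
have [|i [[/asboolP[x ixA] imin] _]] :=
  woI (A := [pred i | `[< exists x : W i, Some (existT _ i x) \in A >]]).
  by case: t tA => i x tA; exists i; apply/asboolP; exists x.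
have [|y [[yA ymin] _]] := wo (A := [pred y : W i | Some (existT _ i y) \in A]).
  by exists x.
exists (Some (existT _ i y)); split=> // -[[j z]|_] => [jA|]; last first.
  exact/asboolP.
have [ij|/eqP nij] := eqVneq i j.
  by subst j; apply/asboolP/sum_le_same; exact: ymin.
by apply/asboolP; left; split=> //; apply: imin; apply/asboolP; exists z.
Qed.

End WellOrderSum.

(** * Ranked types without ordinals *)

Section RankedTypes.
Variables (U : choiceType) (G : set (U -> U)).
Hypothesis hG : permutation_group G.
Implicit Types (F H : set U) (p q x y : U) (f g h k : U -> U).

Let G1 : G id. Proof. by case: hG. Qed.

Let GM f g : G f -> G g -> G (f \o g). Proof. by case: hG => _ _ + _; apply. Qed.

Lemma stabilizer1 F : pointwise_stabilizer G F id. Proof. by split. Qed.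

Lemma stabilizerM F g h : pointwise_stabilizer G F g ->
  pointwise_stabilizer G F h -> pointwise_stabilizer G F (g \o h).
Proof.
move=> [Gg gF] [Gh hF]; split; first exact: GM.
by move=> x Fx /=; rewrite hF// gF.
Qed.

Lemma group_inverse g : G g -> exists h, [/\ G h, cancel g h & cancel h g].
Proof.
case: hG => bij _ _ inv Gg; have [h gK hK] := bij _ Gg.
by exists h; split=> //; exact: inv gK hK.
Qed.

Lemma stabilizer_inverse F g : pointwise_stabilizer G F g ->
  exists h, [/\ pointwise_stabilizer G F h, cancel g h & cancel h g].
Proof.
move=> [Gg gF]; have [h [Gh gK hK]] := group_inverse Gg.
exists h; split=> //; split=> // x Fx.
by rewrite -{1}(gF _ Fx) gK.
Qed.

Lemma sub_stabilizer F F' : F `<=` F' ->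
  pointwise_stabilizer G F' `<=` pointwise_stabilizer G F.
Proof. by move=> FF' g [Gg gF']; split=> // x /FF'; exact: gF'. Qed.

Lemma typeset_refl F p : typeset G F p p.
Proof. by exists id => //; exact: stabilizer1. Qed.

Lemma typeset_sub F p q : typeset G F p q -> typeset G F q `<=` typeset G F p.
Proof.
move=> [g gF <-] _ [h hF <-]; exists (h \o g) => //.
exact: stabilizerM.
Qed.

Lemma typeset_anti F F' p : F `<=` F' -> typeset G F' p `<=` typeset G F p.
Proof. by move=> FF' _ [g gF <-]; exists g => //; exact: sub_stabilizer gF. Qed.

(** The ordinals of [in_rank] are replaced by the derivation itself, which supports direct
    induction; finiteness of [F] becomes a separate hypothesis of the lemmas. *)
Inductive rankable F p : Prop :=
| RankableFin : finite_set (typeset G F p) -> rankable F p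
| RankableStep F' : finite_set F' -> F `<=` F' ->
    (forall q, typeset G F p q -> rankable F' q) -> rankable F p.

Lemma in_rank_homo (W W' : Type) (le : rel W) (le' : rel W') (m : W -> W') :
  wochoice.well_order le' ->
  (forall b a, le b a /\ b <> a -> le' (m b) (m a) /\ m b <> m a) ->
  forall a F p, in_rank G le a F p -> in_rank G le' (m a) F p.
Proof.
(* The recursive premise is nested in an existential, so the structural recursion is written with
   [fix]. *)
move=> wo' mlt; fix IH 4 => a F p [_ finF finT|F' finF finF' FF' step].
  have [min_a|] := pselect (forall b, le' (m a) b); first exact: InRank0.
  (* The image of a minimum need not be minimal. A finite typeset then gets rank [m a] through the
     base [F] itself, all its points having the least rank [z]. *)
  move=> nmin; have [|z [[_ zmin] _]] := wo' predT; first by exists (m a).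
  apply: (InRankS (F' := F)) => // q Tq; exists z; split; last first.
    by apply: InRank0 => // [b|]; [exact: zmin|exact: sub_finite_set (typeset_sub Tq) finT].
  by split; [exact: zmin|move=> za; apply: nmin => b; rewrite -za; exact: zmin].
apply: (InRankS (F' := F')) => // q /step[b [lt_ba rb]].
by exists (m b); split; [exact: mlt|exact: IH].
Qed.

Lemma ranked_rankable F p : ranked G F p -> finite_set F /\ rankable F p.
Proof.
move=> [W [le [_ [a]]]]; move: a F p.
fix IH 4 => a F p [_ finF finT|F' finF finF' FF' step].
  by split=> //; exact: RankableFin.
split=> //; apply: (RankableStep (F' := F')) => // q /step[b [_ rb]].
by have [] := IH _ _ _ rb.
Qed.

(* The ranks of the points of a typeset live in unrelated well-orders; their
   sum along a well-order of U, with a top element added, bounds all of them. *)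
Lemma rankable_ranked F p : finite_set F -> rankable F p -> ranked G F p.
Proof.
move=> + rFp; elim: rFp => {}F {}p.
  move=> finT finF; exists unit, (fun _ _ => true); split; last first.
    by exists tt; exact: InRank0.
  apply: wochoice.antisymmetric_well_order; first by move=> [] [].
  by move=> A [[] aA]; exists tt.
move=> F' finF' FF' _ IH finF.
have /choice[w wP] : forall q, exists w : {W : Type & (rel W * W)%type},
    wochoice.well_order (projT2 w).1 /\
    (typeset G F p q -> in_rank G (projT2 w).1 (projT2 w).2 F' q).
  move=> q; have [/IH/(_ finF')[W [le [wo [a ra]]]]|nT] := pselect (typeset G F p q).
    by exists (existT (fun W : Type => (rel W * W)%type) W (le, a)).
  (* Off the typeset, the one-point order is a filler value. *)
  exists (existT (fun W : Type => (rel W * W)%type) unit (fun _ _ => true, tt)); split=> //=.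
  apply: wochoice.antisymmetric_well_order; first by move=> [] [].
  by move=> A [[] aA]; exists tt.
have [leU woU] := wochoice.well_ordering_principle U.
pose W q := projT1 (w q); pose le q : rel (W q) := (projT2 (w q)).1.
have wo q : wochoice.well_order (le q) by have [] := wP q.
have woS := sum_well_order woU wo.
exists _, (sum_leb leU le); split=> //; exists None.
apply: (InRankS (F' := F')) => // q Tq.
exists (Some (existT W q (projT2 (w q)).2)); split; first by split=> //; exact/asboolP.
apply: (in_rank_homo (le := le q) (m := fun t => Some (existT W q t))) => //.
- move=> b a [lba ba]; have Sba := (sum_le_same leU le b a).2 lba.
  split; first exact/asboolP.
  move=> /= eba; apply: ba; apply: well_order_antisym (wo q) lba _.
  by apply/(sum_le_same leU le); move: Sba; rewrite eba.
- by have [_] := wP q; apply.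
Qed.

Lemma rankable_typeset F p q : rankable F p -> typeset G F p q -> rankable F q.
Proof.
move=> [finT|F' finF' FF' step] Tq.
  by apply: RankableFin; exact: sub_finite_set (typeset_sub Tq) finT.
apply: (RankableStep (F' := F')) => // q' /(typeset_sub Tq); exact: step.
Qed.

Lemma rankable_mem F p : F p -> rankable F p.
Proof.
move=> Fp; apply: RankableFin; apply: sub_finite_set (finite_set1 p).
by move=> _ [g [_ gF] <-]; rewrite gF.
Qed.

Lemma rankable_mono F F' p : finite_set F' -> F `<=` F' ->
  rankable F p -> rankable F' p.
Proof.
move=> + + rFp; elim: rFp F' => {}F {}p.
  move=> finT F' _ FF'; apply: RankableFin.
  exact: sub_finite_set (typeset_anti FF') finT.
move=> F1 finF1 FF1 _ IH F' finF' FF'.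
apply: (RankableStep (F' := F1 `|` F')) => [||q /(typeset_anti FF')/IH].
- by rewrite finite_setU.
- by move=> x; right.
- by apply; [rewrite finite_setU|move=> x; left].
Qed.

(** Conjugation by [k] turns the stabilizer of [F] into that of its image, hence typesets into
    typesets. *)
Lemma rankable_image F p k : G k -> rankable F p -> rankable (k @` F) (k p).
Proof.
move=> Gk; have [k' [Gk' kK k'K]] := group_inverse Gk.
have conj F1 p1 q : typeset G (k @` F1) (k p1) q ->
    exists2 r, typeset G F1 p1 r & q = k r.
  move=> [g [Gg gF] <-]; exists (k' (g (k p1))); last by rewrite k'K.
  exists (k' \o g \o k) => //; split; first by do 2?apply: GM.
  by move=> x Fx /=; rewrite gF//; exists x.
elim=> {}F {}p.
  move=> finT; apply: RankableFin.
  apply: sub_finite_set (finite_image k finT) => q /conj[r Tr ->].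
  by exists r.
move=> F' finF' FF' _ IH; apply: (RankableStep (F' := k @` F')).
- exact: finite_image.
- exact: image_subset.
- by move=> q /conj[r Tr ->]; exact: IH.
Qed.

Lemma rankable_stabilizer F x y k : finite_set F -> pointwise_stabilizer G F k ->
  rankable (F `|` [set x]) y -> rankable (F `|` [set k x]) (k y).
Proof.
move=> finF [Gk kF] /(rankable_image Gk); apply: rankable_mono.
  by rewrite finite_setU.
by move=> _ [z [Fz|->] <-]; [left; rewrite kF|right].
Qed.

(** Induction on the derivation for [x]. A conjugate [k y] is ranked over [F] and [k x]. If the
    orbit of [x] is finite, adding all of it to [F] gives a base that serves every [k y]; otherwise
    the base [F'] witnessing [x] serves, by induction for [k x]. *)
Lemma rankable_trans1 F x y : finite_set F -> rankable F x ->
  rankable (F `|` [set x]) y -> rankable F y.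
Proof.
move=> + rFx; elim: rFx y => {}F {}x.
  move=> finT y finF ry; apply: (RankableStep (F' := F `|` typeset G F x)).
  - by rewrite finite_setU.
  - by move=> z; left.
  - move=> _ [k kF <-]; have := rankable_stabilizer finF kF ry.
    apply: rankable_mono; first by rewrite finite_setU.
    by apply: setUS => _ ->; exists k.
move=> F' finF' FF' _ IH y finF ry; apply: (RankableStep (F' := F')) => //.
move=> _ [k kF <-]; apply: (IH (k x)) => //; first by exists k.
have := rankable_stabilizer finF kF ry.
by apply: rankable_mono; [rewrite finite_setU|exact: setSU].
Qed.

Lemma rankable_trans F F' y : finite_set F -> finite_set F' ->
  (forall x, F' x -> rankable F x) -> rankable (F `|` F') y -> rankable F y.
Proof.
move=> + /finite_seqP[s ->]; elim: s F => [|a s IH] F finF rs.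
  by apply: rankable_mono => //; rewrite subUset; split.
move=> ry; apply: (rankable_trans1 (x := a)) => //.
  by apply: rs; rewrite /= mem_head.
apply: IH; first by rewrite finite_setU.
  move=> x sx; apply: rankable_mono (rs x _).
  - by rewrite finite_setU.
  - by move=> z; left.
  - by rewrite /= inE sx orbT.
apply: rankable_mono ry.
  by rewrite !finite_setU; split; [split|exact: finite_seq].
move=> z [Fz|/=]; first by left; left.
by rewrite inE => /predU1P[->|zs]; [left; right|right].
Qed.

Lemma rcP (S : set U) x :
  rc G S x <-> exists F, [/\ finite_set F, F `<=` S & rankable F x].
Proof.
split=> [[F [finF FS]]|[F [finF FS rFx]]].
  case=> [Fx|[p /ranked_rankable[_ rFp] Tx]]; exists F; split=> //.
    exact: rankable_mem.
  exact: rankable_typeset Tx.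
exists F => //; right; exists x; last exact: typeset_refl.
exact: rankable_ranked.
Qed.

(** * Ranges of maps in the closure of the group *)

Definition locally_in_group f :=
  forall K, finite_set K -> exists2 g, G g & forall x, K x -> f x = g x.

Lemma locally_in_groupM f g : G g -> locally_in_group f -> locally_in_group (g \o f).
Proof.
move=> Gg lf K /lf[h Gh fh]; exists (g \o h); first exact: GM.
by move=> x Kx /=; rewrite fh.
Qed.

(** On a finite orbit [f] agrees with a group element, which permutes the orbit. In the other case,
    with [g] agreeing with [f] on [F'] and [h] its inverse, [h \o f] fixes [F'], so induction puts
    [h x] in its range. *)
Lemma rankable_range_fix F x f : finite_set F -> rankable F x ->
  locally_in_group f -> (forall y, F y -> f y = y) -> range f x.
Proof.
move=> + rFx; elim: rFx f => {}F {}x.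
  move=> finT f finF lf fF.
  have [|g Gg fg] := lf (F `|` typeset G F x); first by rewrite finite_setU.
  have gF : pointwise_stabilizer G F g.
    by split=> // y Fy; rewrite -fg ?fF//; left.
  have [h [hF _ hK]] := stabilizer_inverse gF.
  have Thx : typeset G F x (h x) by exists h.
  by exists (h x) => //; rewrite fg ?hK//; right.
move=> F' finF' FF' _ IH f finF lf fF.
have [g Gg fg] := lf _ finF'.
have gF : pointwise_stabilizer G F g.
  by split=> // y Fy; rewrite -fg ?fF//; exact: FF'.
have [h [hF gK hK]] := stabilizer_inverse gF.
have [||||y _ /= yx] := IH (h x) _ (h \o f) => //.
- by exists h.
- by apply: locally_in_groupM => //; case: hF.
- by move=> y F'y /=; rewrite fg// gK.
- by exists y => //; rewrite -(hK (f y)) yx hK.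
Qed.

(** Choosing preimages of [F] and precomposing [f] with the inverse of a group element that agrees
    with [f] on them reduces to a map fixing [F]. *)
Lemma rankable_range F x f : finite_set F -> rankable F x ->
  locally_in_group f -> F `<=` range f -> range f x.
Proof.
move=> finF rFx lf Ff.
have /choice[r rP] : forall y, exists z, F y -> f z = y.
  move=> y; have [/Ff[z _ <-]|nFy] := pselect (F y); first by exists z.
  by exists y.
have [g Gg fg] := lf _ (finite_image r finF).
have [h [Gh gK hK]] := group_inverse Gg.
have lfh : locally_in_group (f \o h).
  move=> K finK; have [g' Gg' fg'] := lf _ (finite_image h finK).
  exists (g' \o h); first exact: GM.
  by move=> y Ky /=; apply: fg'; exists y.
have [y _ <-] : range (f \o h) x.
  apply: rankable_range_fix rFx lfh _ => // y Fy /=.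
  have -> : h y = r y by rewrite -{1}(rP _ Fy) fg ?gK//; exists y.
  exact: rP.
by exists (h y).
Qed.

(** * Moving and avoiding unranked points *)

Lemma move_unrankable H H' (s : seq U) : finite_set H' -> H `<=` H' ->
  (forall e, e \in s -> ~ rankable H e) ->
  exists2 k, pointwise_stabilizer G H k & forall e, e \in s -> ~ rankable H' (k e).
Proof.
have [n] := ubnP (size s); elim: n => // n IH in H H' s *.
rewrite ltnS => sn finH' HH' sH.
have finH := sub_finite_set HH' finH'.
have finU1 F x : finite_set F -> finite_set (F `|` [set x]).
  by move=> finF; rewrite finite_setU.
have [->|s0] := eqVneq s [::]; first by exists id => //; exact: stabilizer1.
have [||m ms mmin] := @finite_minimal _ (fun x y => rankable (H `|` [set y]) x) s.
- move=> x y z ryx rzy; apply: (rankable_trans1 (x := y)) => //; first exact: finU1.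
  by apply: rankable_mono ryx; [exact: (finU1 _ _ (finU1 _ _ finH))|exact/setSU/subsetUl].
- exact/eqP.
(* Otherwise the whole orbit of [m] is ranked over [H'], which makes [m] ranked over [H]. *)
have [k1 k1H k1m] : exists2 k1, pointwise_stabilizer G H k1 & ~ rankable H' (k1 m).
  apply: contrapT => nk; apply: (sH m ms); apply: (RankableStep (F' := H')) => //.
  by move=> _ [k kH <-]; apply: contrapT => nr; apply: nk; exists k.
(* The list loses at least [m]; what remains is moved while [k1 m] stays fixed. *)
pose s' := [seq x <- s | ~~ `[< rankable (H `|` [set m]) x >]].
have [||||k2 k2H k2s] := IH (H `|` [set k1 m]) (H' `|` [set k1 m]) (map k1 s').
- rewrite size_map; apply: leq_trans sn; rewrite size_filter ltn_neqAle count_size andbT.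
  rewrite -all_count; apply/negP => /allP/(_ _ ms)/negP; apply; apply/asboolP.
  by apply: rankable_mem; right.
- exact: finU1.
- exact: setSU.
- move=> _ /mapP[e + ->]; rewrite mem_filter => /andP[/asboolP ne _] re.
  have [k1' [k1'H k1K _]] := stabilizer_inverse k1H.
  by have := rankable_stabilizer finH k1'H re; rewrite !k1K.
have k2H' : pointwise_stabilizer G H k2 by apply: sub_stabilizer k2H; exact: subsetUl.
exists (k2 \o k1); first exact: stabilizerM.
move=> e es /= re; have [rme|nrme] := pselect (rankable (H `|` [set m]) e); last first.
  apply: (k2s (k1 e)); first by apply: map_f; rewrite mem_filter es andbT; exact/asboolP.
  by apply: rankable_mono re; [exact: finU1|exact: subsetUl].
(* By minimality [m] is ranked over [H] and [e]. Applying [k2 \o k1], which sends [m] to [k1 m], a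
   ranked image of [e] over [H'] would make [k1 m] ranked over [H']. *)
have := rankable_stabilizer finH (stabilizerM k2H' k1H) (mmin _ es rme).
have [_ /(_ (k1 m) (or_intror erefl)) k2m] := k2H; rewrite /= k2m => rm.
apply: k1m; apply: (rankable_trans1 (x := k2 (k1 e))) => //.
by apply: rankable_mono rm; [exact: finU1|exact: setSU].
Qed.

(** Instead of moving the points of [s] off the closure of [H] and [v], the inverse motion is
    applied to [v]. *)
Lemma extend_unrankable H (s : seq U) v : finite_set H ->
  (forall e, e \in s -> ~ rankable H e) ->
  exists2 h, pointwise_stabilizer G H h &
    forall e, e \in s -> ~ rankable (H `|` [set h v]) e.
Proof.
move=> finH sH; have finHv : finite_set (H `|` [set v]) by rewrite finite_setU.
have [k kH ks] := move_unrankable finHv (@subsetUl _ _ _) sH.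
have [h [hH _ hK]] := stabilizer_inverse kH.
exists h => // e /ks nr re; apply: nr.
by have := rankable_stabilizer finH kH re; rewrite hK.
Qed.

Lemma avoid_unrankable (u : nat -> U) F (s : seq U) :
  (forall x, exists n, u n = x) -> finite_set F ->
  (forall e, e \in s -> ~ rankable F e) ->
  exists f, [/\ locally_in_group f, F `<=` range f &
    forall e, e \in s -> ~ range f e].
Proof.
move=> /choice[idx uK] finF sF.
pose K n := F `|` u @` `I_n.
have finK n : finite_set (K n).
  by rewrite finite_setU; split=> //; apply: finite_image; exact: finite_II.
have Kmono n n' : (n <= n')%N -> K n `<=` K n'.
  by move=> nn'; apply: setUS => _ [i /= lt_in <-]; exists i => //=; exact: leq_trans nn'.
(* Stage [n] fixes the values on [K n] for good; keeping [s] unranked over them leaves room for the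
   value at [u n]. *)
pose inv n g := G g /\ forall e, e \in s -> ~ rankable (g @` K n) e.
have /choice[next nextP] : forall ng : nat * (U -> U), exists g',
    inv ng.1 ng.2 -> inv ng.1.+1 g' /\ forall x, K ng.1 x -> g' x = ng.2 x.
  move=> [n g] /=; have [[Gg gs]|] := pselect (inv n g); last by exists g.
  have [h [Gh hK] hs] := extend_unrankable (g (u n)) (finite_image g (finK n)) gs.
  exists (h \o g) => _; split; last by move=> x Kx /=; rewrite hK//; exists x.
  split=> [|e /hs nr]; first exact: GM.
  apply: contra_not nr; apply: rankable_mono.
    by rewrite finite_setU; split=> //; exact: finite_image.
  have hgK x : K n x -> (g @` K n `|` [set h (g (u n))]) ((h \o g) x).
    by move=> Kx; left; rewrite /= hK; [exists x|exists x].
  move=> _ [x [Fx|[i /= lt_in <-]] <-]; first by apply: hgK; left.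
  move: lt_in; rewrite ltnS leq_eqVlt => /predU1P[->|lt_in]; first by right.
  by apply: hgK; right; exists i.
pose gs := fix gs n := if n is m.+1 then next (m, gs m) else id.
have gsP n : inv n (gs n).
  elim: n => [|n /(nextP (n, _))[]//].
  split=> // e /sF; apply: contra_not; apply: rankable_mono => //.
  by move=> _ [x Kx <-]; case: Kx => // -[i].
have gsK n n' x : (n <= n')%N -> K n x -> gs n' x = gs n x.
  move=> + Kx; elim: n' => [|n' IH]; first by rewrite leqn0 => /eqP ->.
  rewrite leq_eqVlt => /predU1P[-> //|]; rewrite ltnS => nn'.
  have [_ /= nextK] := nextP (n', _) (gsP n').
  by rewrite nextK; [exact: IH|exact: Kmono nn' _ Kx].
(* [x] is the point [u (idx x)], which enters [K] only at the next index. *)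
pose f x := gs (idx x).+1 x.
have Kx x : K (idx x).+1 x by right; exists (idx x); rewrite /= ?uK.
exists f; split.
- move=> _ /finite_seqP[t ->]; exists (gs (\max_(x <- t) (idx x).+1)).
    by have [] := gsP (\max_(x <- t) (idx x).+1).
  move=> x xt; rewrite (gsK (idx x).+1) //.
  exact: leq_bigmax_seq.
- move=> x Fx; exists x => //.
  (* [gs 0] is the identity and [F] lies in [K 0], so [f] fixes [F]. *)
  by rewrite /f (gsK 0%N) //; left.
- move=> e /[dup] es _ [x _ fx]; have [_ /(_ _ es)] := gsP (idx x).+1; apply.
  by apply: rankable_mem; exists x.
Qed.

(** * Translation of the two closures into finite conditions *)

Lemma GbarP f : Gbar G f <-> locally_in_group f.
Proof.
pose T : topologicalType := {ptws U -> discrete_topology U}.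
split=> [cf _ /finite_seqP[s ->]|lf].
  have nbf : nbhs (f : T) [set h | forall x, x \in s -> h x = f x].
    elim: s => [|a s IH]; first by apply: filterS filterT => h _ x.
    have fa : nbhs (f : T) [set h | h a = f a].
      exact: (@proj_continuous _ (fun _ => discrete_topology U) a f _
        (discrete_set1 (f a : discrete_topology U))).
    apply: filterS (filterI fa IH) => h [/= ha hs] x.
    by rewrite inE => /predU1P[->|/hs].
  by have [g [Gg gs]] := cf _ nbf; exists g => // x xs; rewrite gs.
(* [N] is generated by the conditions of agreeing with [f] on a finite set; it converges to [f]
   because it does so at each coordinate. *)
pose N : set_system T := [set A |
  exists2 K, finite_set K & forall h, (forall x, K x -> h x = f x) -> A h].
have fN : Filter N.
  split.
  - by exists set0.
  - move=> A B [K finK KA] [L finL LB]; exists (K `|` L).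
      by rewrite finite_setU.
    by move=> h hf; split; [apply: KA|apply: LB] => x Kx; apply: hf; [left|right].
  - by move=> A B AB [K finK KA]; exists K => // h /KA/AB.
have cN : N --> (f : T).
  apply/cvg_sup => x A; rewrite nbhsE => -[_ [[B _ <-] Bf BA]].
  exists [set x]; first exact: finite_set1.
  by move=> h hf; apply: BA; rewrite /preimage /= hf.
move=> B /cN[K /lf[g Gg fg] KB]; exists g; split=> //.
by apply: KB => x Kx; rewrite fg.
Qed.

Lemma Gbar_images_closureP (Y : set U) :
  Gbar_images_closure G Y <-> forall F E, finite_set F -> finite_set E ->
    F `<=` Y -> E `&` Y = set0 ->
    exists f, [/\ locally_in_group f, F `<=` range f & E `&` range f = set0].
Proof.
split=> [cY F E finF finE FY EY|hY].
  have nbY : nbhs (Y : powerset_topology U) (powerset_base (F, E)).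
    rewrite nbhsE; exists (powerset_base (F, E)) => //; split=> //.
    exists [set (F, E)]; first by move=> _ ->.
    by rewrite bigcup_set1.
  by have [_ [[f /GbarP lf <-] [/= Ff Ef]]] := cY _ nbY; exists f.
move=> B; rewrite nbhsE => -[_ [[I0 I0fin <-] [[F E] IFE [/= FY EY]] sB]].
have [/= finF finE] := I0fin _ IFE.
have [f [lf Ff Ef]] := hY F E finF finE FY EY.
exists (range f); split; first by exists f => //; exact/GbarP.
by apply: sB; exists (F, E).
Qed.

(** Rankability is monotone in the base, so the union of the bases of the single points serves them
    all. *)
Lemma finite_sub_rc (S F : set U) : finite_set F -> F `<=` rc G S ->
  exists F0, [/\ finite_set F0, F0 `<=` S & forall x, F x -> rankable F0 x].
Proof.
move=> /finite_seqP[s ->]; elim: s => [|a s IH] sS.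
  by exists set0; split.
have [|F0 [finF0 F0S F0s]] := IH.
  by move=> x xs; apply: sS; rewrite /= inE; apply/orP; right.
have /rcP[F1 [finF1 F1S F1a]] : rc G S a by apply: sS; rewrite /= mem_head.
have finF01 : finite_set (F0 `|` F1) by rewrite finite_setU.
exists (F0 `|` F1); split=> //; first by rewrite subUset.
move=> x /=; rewrite inE => /predU1P[->|/F0s].
  exact: rankable_mono finF01 (@subsetUr _ _ _) F1a.
exact: rankable_mono finF01 (@subsetUl _ _ _).
Qed.

End RankedTypes.

Theorem theorem9p4 (U : choiceType) (G : set (U -> U)) (S : set U) :
  [set: U] #= [set: nat] ->
  permutation_group G ->
  least_containing (Gbar_images_closure G) S (rc G S).
Proof.
move=> /card_set_bijP[c [_ cinj csurj]] hG; split.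
- apply/Gbar_images_closureP => F E finF finE FS ES.
  have [F0 [finF0 F0S F0F]] := finite_sub_rc hG finF FS.
  have /choice[u cu] : forall n, exists x, c x = n.
    by move=> n; have [x _ <-] := csurj n I; exists x.
  have usurj x : exists n, u n = x by exists (c x); apply: cinj; rewrite ?inE ?cu.
  have /finite_seqP[s sE] := finE.
  have finF01 : finite_set (F0 `|` F) by rewrite finite_setU.
  (* A point of [E] ranked over [F0] and [F] would by transitivity be ranked over [F0], hence lie in
     [rc G S]. *)
  have [e es /(rankable_trans hG finF0 finF F0F) re|f [lf Ff sf]] :=
    avoid_unrankable hG usurj (s := s) finF01.
    have : (E `&` rc G S) e.
      by split; [rewrite sE|apply/rcP => //; exists F0].
    by rewrite ES.
  exists f; split=> //; first by move=> x Fx; apply: Ff; right.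
  by apply/seteqP; split=> // e []; rewrite {1}sE => /sf.
- by move=> x Sx; exists [set x]; [split; [exact: finite_set1|move=> _ ->]|left].
- move=> Y /Gbar_images_closureP cY SY x /(rcP hG)[F [finF FS rFx]].
  apply: contrapT => nYx.
  (* If [x] is not in [Y], some range contains [F] and misses [x], although [x] is ranked over
     [F]. *)
  have [||||f [lf Ff xf]] := cY F [set x] => //.
  + exact: subset_trans SY.
  + by apply/seteqP; split=> // y [-> ].
  have : ([set x] `&` range f) x by split=> //; exact: rankable_range rFx lf Ff.
  by rewrite xf.
Qed.
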